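(* Let $P_1,\dots,P_n$ be discrete Borel probability measures on $\mathbb{R}$ whose set of common atoms $A=\{x\in\mathbb{R}: P_i(\{x\})>0 \text{ for all } i=1,\dots,n\}$ is nonempty. Then the conflation $\&(P_1,\dots,P_n)$ is the unique Borel probability distribution that minimizes, over all single Borel probability distributions $Q$ on $\mathbb{R}$, the maximum loss of Shannon Information between $Q$ and $P_1,\dots,P_n$.
   Context: $\delta_x$ is the Dirac measure at $x$, and $\|\mu\|$ is the total mass of a Borel sub-probability measure $\mu$. For Borel probability measures $P_1,\dots,P_n$ on $\mathbb{R}$ and $j\in\mathbb{N}$, define the sub-probability measure $$\mu_j(P_1,\dots,P_n)=\sum_{k\in\mathbb{Z}}\ \prod_{i=1}^n P_i\big(((k-1)2^{-j},k2^{-j}]\big)\,\delta_{k2^{-j}}.$$ If $\mu_j(P_1,\dots,P_n)/\|\mu_j(P_1,\dots,P_n)\|$ converges vaguely, as $j\to\infty$, to a Borel probability measure $Q$, then $Q$ is called the conflation of $P_1,\dots,P_n$ and is written $\&(P_1,\dots,P_n)$. Vague convergence $\nu_j\to\nu$ of sub-probability measures means $\int f\,d\nu_j\to\int f\,d\nu$ for all continuous $f$ vanishing at infinity. The Shannon Information of a probability measure $P$ for a Borel set $B$ is $S_P(B)=-\log_2 P(B)$ (with $-\log_2 0=+\infty$). The joint Shannon Information of $P_1,\dots,P_n$ for $B$ is $S_{\{P_1,\dots,P_n\}}(B)=\sum_{i=1}^n S_{P_i}(B)=-\log_2\prod_{i=1}^n P_i(B)$. The loss between the Shannon Information of $Q$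 and $P_1,\dots,P_n$ for the event $B$ is $S_{\{P_1,\dots,P_n\}}(B)-S_Q(B)$ if $\prod_{i=1}^n P_i(B)>0$, and is $0$ if $Q(B)=\prod_{i=1}^n P_i(B)=0$; if $\prod_{i=1}^n P_i(B)=0<Q(B)$ the loss is $S_{\{P_1,\dots,P_n\}}(B)-S_Q(B)=+\infty$. The maximum loss between the Shannon Information of $Q$ and $P_1,\dots,P_n$ is the maximum (supremum) of these losses over all Borel sets $B\subset\mathbb{R}$. *)

(* Defs.v *)
From HB Require Import structures.
From mathcomp Require Import all_boot all_order all_algebra.
From mathcomp Require Import all_classical all_reals all_analysis.

Set Implicit Arguments.
Unset Strict Implicit.
Unset Printing Implicit Defensive.

Import Order.TTheory GRing.Theory Num.Theory.
Import numFieldNormedType.Exports.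

Local Open Scope classical_set_scope.
Local Open Scope ring_scope.
Local Open Scope ereal_scope.

Notation borel_prob R := (probability (measurableTypeR R) R).

Section conflation.
Context {R : realType} {n : nat}.
Implicit Types (P : 'I_n -> borel_prob R) (j : nat) (k : int).

Definition dyadic_point j k : R := (k%:~R * 2 ^- j)%R.

Definition dyadic_itv j k : set R :=
  `](dyadic_point j (k - 1)%R), (dyadic_point j k)]%classic.

Definition dyadic_weight P j k : \bar R := \prod_(i < n) P i (dyadic_itv j k).

Lemma dyadic_weight_ge0 P j k : 0 <= dyadic_weight P j k.
Proof. by apply: prode_ge0 => i _; exact: measure_ge0. Qed.

Lemma dyadic_weight_fin_num P j k : dyadic_weight P j k \is a fin_num.
Proof.
apply: prode_fin_num => i _; apply: fin_num_measure; exact: measurable_itv.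
Qed.

Definition mu_dyadic P j : set (measurableTypeR R) -> \bar R := fun B =>
  \esum_(k in [set: int])
    (dyadic_weight P j k * @dirac _ (measurableTypeR R) (dyadic_point j k) R B).

Let mu_dyadic0 P j : mu_dyadic P j set0 = 0.
Proof. by apply: esum1 => k _; rewrite measure0 mule0. Qed.

Let mu_dyadic_ge0 P j B : 0 <= mu_dyadic P j B.
Proof.
by apply: esum_ge0 => k _; rewrite mule_ge0// dyadic_weight_ge0.
Qed.

Let mu_dyadic_sigma_additive P j : semi_sigma_additive (mu_dyadic P j).
Proof.
move=> F mF tF mUF.
have w0 k i : 0 <= dyadic_weight P j k *
    @dirac _ (measurableTypeR R) (dyadic_point j k) R (F i).
  by rewrite mule_ge0// dyadic_weight_ge0.
have -> : mu_dyadic P j (\bigcup_i F i) = \sum_(i <oo) mu_dyadic P j (F i).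
  rewrite nneseries_esumT; last by move=> i; exact: mu_dyadic_ge0.
  rewrite /mu_dyadic (esum_esum (J := fun=> [set: int]))//.
  rewrite (reindex_esum ([set: int] `*` [set: nat]) _
    (fun x => (x.2, x.1)))/=; last first.
    split=> //= [[k1 i1] [k2 i2] _ _ [-> ->]//|[i k] _]; by exists (k, i).
  rewrite -(@esum_esum _ _ _ _ (fun=> [set: nat]) (fun k i =>
    dyadic_weight P j k *
    @dirac _ (measurableTypeR R) (dyadic_point j k) R (F i)))//.
  apply: eq_esum => k _.
  rewrite measure_semi_bigcup// -nneseries_esumT//.
  by rewrite -(fineK (dyadic_weight_fin_num P j k)) nneseriesZl.
apply: is_cvg_ereal_nneg_natsum => i _; exact: mu_dyadic_ge0.
Qed.

HB.instance Definition _ P j := isMeasure.Build _ _ _ (mu_dyadic P j)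
  (mu_dyadic0 P j) (mu_dyadic_ge0 P j) (@mu_dyadic_sigma_additive P j).

End conflation.

Section vague_convergence.
Context {R : realType}.

Definition vanishes_at_infinity (f : R -> R) : Prop :=
  (f x @[x --> +oo%R] --> (0 : R)%R) /\ (f x @[x --> -oo%R] --> (0 : R)%R).

Definition vague_cvg (nu : nat -> {measure set (measurableTypeR R) -> \bar R})
    (nu0 : {measure set (measurableTypeR R) -> \bar R}) : Prop :=
  forall f : R -> R, continuous f -> vanishes_at_infinity f ->
    \int[nu j]_x (f x)%:E @[j --> \oo] --> \int[nu0]_x (f x)%:E.

Lemma inv_mass_ge0 (m : {measure set (measurableTypeR R) -> \bar R}) :
  (0 <= (fine (m setT))^-1)%R.
Proof. by rewrite invr_ge0 fine_ge0. Qed.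

(* When the total mass of [m] is 0, this is the null measure (0^-1 = 0), and a
   sequence of null measures has no vague limit of mass 1. *)
Definition normalized (m : {measure set (measurableTypeR R) -> \bar R}) :
    {measure set (measurableTypeR R) -> \bar R} :=
  mscale (NngNum (inv_mass_ge0 m)) m.

End vague_convergence.

Definition is_conflation (R : realType) (n : nat) (P : 'I_n -> borel_prob R)
    (Q : borel_prob R) : Prop :=
  vague_cvg (fun j => normalized (mu_dyadic P j)) Q.

Section shannon.
Context {R : realType} {n : nat}.
Implicit Types (P : 'I_n -> borel_prob R) (Q : borel_prob R)
  (B : set (measurableTypeR R)).

(* [lne 0 = -oo], so the information of a null event is [+oo]. *)
Definition shannon Q B : \bar R := - (lne (Q B) * (ln 2)^-1%:E).

Definition joint_shannon P B : \bar R := \sum_(i < n) shannon (P i) B.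

(* The difference below is never [+oo - +oo] : [joint_shannon P B] is [+oo] only
   when the product vanishes, and then [Q B] is positive in the second branch. *)
Definition loss Q P B : \bar R :=
  if (\prod_(i < n) P i B == 0) && (Q B == 0) then 0
  else joint_shannon P B - shannon Q B.

Definition max_loss Q P : \bar R :=
  ereal_sup [set loss Q P B | B in [set B | measurable B]].

Definition minimizes_max_loss P Q : Prop :=
  forall Q' : borel_prob R, max_loss Q P <= max_loss Q' P.

End shannon.

Definition discrete_probability (R : realType) (Q : borel_prob R) : Prop :=
  exists2 D : set R, countable D & Q D = 1.

Definition common_atoms (R : realType) (n : nat) (P : 'I_n -> borel_prob R) :
  set R := [set x | forall i, 0 < P i [set x]].

(* A measure is a function on all subsets, constrained on measurable ones only;
   equality of measures is therefore equality on Borel sets. *)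
Definition same_distribution (R : realType) (Q Q' : borel_prob R) : Prop :=
  forall B : set (measurableTypeR R), measurable B -> Q B = Q' B.

(* Main.v *)
From HB Require Import structures.
Require Import Defs.
From mathcomp Require Import all_boot all_order all_algebra.
From mathcomp Require Import all_classical all_reals all_analysis.
From mathcomp Require Import measurable_realfun.
(* This import comes last: [dyadic_itv] must denote the half-open interval used
   to define the conflation, and another constant bears the same name. *)
Import Defs.

Set Implicit Arguments.
Unset Strict Implicit.
Unset Printing Implicit Defensive.

Import Order.TTheory GRing.Theory Num.Theory.
Import numFieldNormedType.Exports.
Import HBNNSimple.

Local Open Scope classical_set_scope.

(** Fix one index [i0].  The whole argument is carried by the density
    [h x = \prod_(i != i0) P i {x}] with respect to [P i0]: the measure
    [nu = h P_i0] charges a point [x] with [\prod_i P i {x}], its total mass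
    [z] lies in [(0, 1]] when there is a common atom, and [Q0 = nu / z] is the
    distribution of the theorem.

    [Q0] is the conflation.  Let [c_j x] be the right endpoint of the dyadic
    interval [I_j x] of level [j] containing [x], and
    [g_j x = \prod_(i != i0) P i (I_j x)].  The discretized measure [mu_j] is
    the image under [c_j] of the measure of density [g_j] with respect to
    [P i0] ([mu_dyadicE]), so that the integral of a test function [f] against
    [mu_j] is the integral of [g_j * (f \o c_j)] against [P i0].  As [I_j x]
    shrinks to [{x}], dominated convergence on the single measure [P i0] gives
    the limit, the integral of [h * f] ([cvg_integral_mu_dyadic]); the case
    [f = 1] shows that the masses of the [mu_j] tend to [z].  A vague
    limit which is a probability is determined on Borel sets
    ([vanishing_integrals_unique]), so any conflation agrees with [Q0].

    [Q0] is the unique minimizer.  The loss of [Q] on [B] is at most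
    [- log_2 z] exactly when [Q B <= z^-1 * \prod_i P i B] ([loss_leP]).  For
    [Q0] this holds because [h x <= \prod_(i != i0) P i B] for [x] in [B]
    ([atom_product_le]); hence the maximum loss of [Q0] is at most [- log_2 z].
    Conversely, if the maximum loss of [Q] is at most [- log_2 z], then [Q] is
    null outside a countable set carrying [P i0], and [Q {x} <= Q0 {x}] for
    every point [x]; summing over that countable set, [Q <= Q0]
    ([atom_product_dominating]), and two comparable probabilities are equal.
    Thus every [Q] other than [Q0] has a maximum loss greater than
    [- log_2 z]. *)

Local Open Scope ring_scope.
Local Open Scope ereal_scope.

(** * Measures on the line *)

Section measures_on_the_line.
Context {R : realType}.
Implicit Types (Q : borel_prob R) (B : set (measurableTypeR R)).

Lemma probability_fin_num Q B : measurable B -> Q B \is a fin_num.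
Proof. by move=> mB; exact: fin_num_measure. Qed.

Lemma dominated_probability_eq Q Q' :
  (forall B, measurable B -> Q' B <= Q B) -> same_distribution Q' Q.
Proof.
move=> QQ' B mB; apply/eqP; rewrite eq_le QQ'//=.
have := QQ' _ (measurableC mB); rewrite !probability_setC//.
by rewrite leeD2lE// leeN2.
Qed.

(** The bound on [f] and the finiteness of [m] make both parts of [f]
    integrable; without them the two sides could involve [+oo - +oo]. *)
Lemma integral_normalized (m : {measure set (measurableTypeR R) -> \bar R})
    (f : R -> R) (M : R) :
  m setT < +oo -> measurable_fun [set: measurableTypeR R] f ->
  (forall x, (`|f x| <= M)%R) ->
  \int[normalized m]_x (f x)%:E =
  (fine (m setT))^-1%:E * \int[m]_x (f x)%:E.
Proof.
move=> moo mf fM.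
have intf : m.-integrable setT (EFin \o f).
  apply: measurable_bounded_integrable => //.
  exists M; split; first exact: num_real.
  by move=> K MK x _ /=; rewrite (le_trans (fM x))// ltW.
have mEf : measurable_fun [set: measurableTypeR R] (EFin \o f).
  exact/measurable_EFinP.
rewrite [LHS]integralE [in RHS]integralE /normalized !ge0_integral_mscale//=.
- rewrite [RHS]muleBr//; apply: fin_num_adde_defl; rewrite fin_numN.
  exact: integrable_neg_fin_num.
- exact: measurable_funeneg.
- exact: measurable_funepos.
Qed.

End measures_on_the_line.

(** * Shannon information and probability ratios *)

Section information.
Context {R : realType} {n : nat}.
Implicit Types (P : 'I_n -> borel_prob R) (Q : borel_prob R)
  (B : set (measurableTypeR R)).

Lemma shannon_ge0 Q B : measurable B -> 0 <= shannon Q B.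
Proof.
move=> mB; rewrite /shannon oppe_ge0 mule_le0_ge0 ?lne_le0 ?probability_le1//.
by rewrite lee_fin invr_ge0 ln_ge0// ler1n.
Qed.

Lemma shannon_null Q B : Q B = 0 -> shannon Q B = +oo.
Proof.
move=> QB0; rewrite /shannon QB0 le0_lneNy//.
by rewrite mulNyr gtr0_sg ?mul1e// invr_gt0 ln_gt0// ltr1n.
Qed.

Lemma shannon_EFin Q B (q : R) : (0 < q)%R -> Q B = q%:E ->
  shannon Q B = (- (ln q / ln 2))%:E.
Proof. by move=> q0 QB; rewrite /shannon QB lne_EFin. Qed.

Lemma joint_shannon_null P B : measurable B ->
  \prod_(i < n) P i B = 0 -> joint_shannon P B = +oo.
Proof.
move=> mB P0.
have [i PiB] : exists i, P i B = 0.
  move: P0; under eq_bigr do rewrite -[P _ B]fineK ?fin_num_measure//.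
  rewrite prodEFin => -[] /eqP/prodf_eq0[i _ /eqP Pi0]; exists i.
  by rewrite -[LHS]fineK ?fin_num_measure// Pi0.
rewrite /joint_shannon (bigD1 i)//= shannon_null// addye//.
apply/eqP => h; have : 0 <= \sum_(i0 < n | i0 != i) shannon (P i0) B.
  by apply: sume_ge0 => k _; exact: shannon_ge0.
by rewrite h.
Qed.

Lemma joint_shannon_EFin P B (p : R) : measurable B -> (0 < p)%R ->
  \prod_(i < n) P i B = p%:E -> joint_shannon P B = (- (ln p / ln 2))%:E.
Proof.
move=> mB p0 PB; pose q i := fine (P i B).
have qE i : P i B = (q i)%:E by rewrite fineK ?fin_num_measure.
have pE : p = (\prod_(i < n) q i)%R.
  by apply: EFin_inj; rewrite -PB -prodEFin; apply: eq_bigr.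
have q0 i : (0 < q i)%R.
  rewrite lt_neqAle fine_ge0// andbT eq_sym; apply/eqP => qi0.
  by move: p0; rewrite pE (bigD1 i)//= qi0 mul0r ltxx.
rewrite /joint_shannon (eq_bigr (fun i => (- (ln (q i) / ln 2))%:E));
  last by move=> i _; exact: shannon_EFin.
rewrite sumEFin sumrN -mulr_suml pE; congr (- (_ / _))%:E.
suff : (0 < \prod_(i < n) q i)%R /\
  (\sum_(i < n) ln (q i) = ln (\prod_(i < n) q i))%R by case.
elim/big_rec2 : _ => [|i y1 y2 _ [y0 ->]]; first by rewrite ln1.
by rewrite mulr_gt0// lnM// posrE.
Qed.

(** Bounding the loss by the constant [- log_2 z] amounts to bounding the ratio
    of [Q B] to the product of the [P i B] by [z^-1], including in the cases
    where one of them vanishes; [z <= 1] is used when both do. *)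
Lemma loss_leP P Q B (z : R) : measurable B -> (0 < z <= 1)%R ->
  loss Q P B <= (- (ln z / ln 2))%:E <->
  Q B <= z^-1%:E * \prod_(i < n) P i B.
Proof.
move=> mB /andP[z0 z1]; have ln2 : (0 < ln 2 :> R)%R by rewrite ln_gt0// ltr1n.
have [q qE] : exists q, Q B = q%:E.
  by exists (fine (Q B)); rewrite fineK ?fin_num_measure.
have [p pE] : exists p, \prod_(i < n) P i B = p%:E.
  by apply: EFin_fin_numP; apply: prode_fin_num => i _; exact: fin_num_measure.
have q0 : (0 <= q)%R by rewrite -lee_fin -qE.
have p0 : (0 <= p)%R by rewrite -lee_fin -pE prode_ge0.
rewrite /loss pE qE !eqe -EFinM lee_fin.
have [pz|pnz] := eqVneq p 0%R; have [qz|qnz] := eqVneq q 0%R => /=.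
- rewrite pz qz mulr0; split => // _.
  by rewrite lee_fin -mulNr mulr_ge0 ?oppr_ge0 ?ln_le0// invr_ge0 ltW.
- have {}q0 : (0 < q)%R by rewrite lt_neqAle eq_sym qnz.
  rewrite pz mulr0 [in X in _ <-> X]leNgt q0/=; rewrite pz in pE.
  by rewrite joint_shannon_null// (shannon_EFin q0 qE).
- have {}p0 : (0 < p)%R by rewrite lt_neqAle eq_sym pnz.
  rewrite qz mulr_ge0 ?invr_ge0 ?(ltW z0) ?(ltW p0)//; split => // _.
  rewrite qz in qE; rewrite shannon_null// (joint_shannon_EFin mB p0 pE).
  by rewrite leNye.
- have {}p0 : (0 < p)%R by rewrite lt_neqAle eq_sym pnz.
  have {}q0 : (0 < q)%R by rewrite lt_neqAle eq_sym qnz.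
  rewrite (shannon_EFin q0 qE) (joint_shannon_EFin mB p0 pE) -EFinB lee_fin.
  rewrite opprK -!mulNr -mulrDl ler_pM2r ?invr_gt0//.
  rewrite [(- ln p + _)%R]addrC lerBlDr addrC -lnV ?posrE//.
  rewrite -lnM ?posrE ?invr_gt0//.
  by rewrite ler_ln ?posrE ?mulr_gt0 ?invr_gt0// mulrC.
Qed.

Lemma max_loss_leP P Q (z : R) : (0 < z <= 1)%R ->
  max_loss Q P <= (- (ln z / ln 2))%:E <->
  (forall B, measurable B -> Q B <= z^-1%:E * \prod_(i < n) P i B).
Proof.
move=> z01; split => [h B mB|h].
  apply/(loss_leP _ _ mB z01); apply: le_trans h; apply: ereal_sup_ubound.
  by exists B.
by apply: ge_ereal_sup => _ [B mB <-]; apply/(loss_leP _ _ mB z01)/h.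
Qed.

Lemma same_distribution_max_loss P Q Q' :
  same_distribution Q Q' -> max_loss Q P = max_loss Q' P.
Proof.
move=> QQ'; rewrite /max_loss; congr ereal_sup.
apply/seteqP; split => _ [B mB <-]; exists B => //;
by rewrite /loss /shannon QQ'.
Qed.

End information.

(** * Vague limits determine distributions *)

Section test_functions.
Context {R : realType}.

Lemma vanishing_bounded (f : R -> R) : continuous f -> vanishes_at_infinity f ->
  exists M, forall x, (`|f x| <= M)%R.
Proof.
move=> cf [fy fNy].
have [a [_ fa]] := @cvgr0_norm_le _ _ _ _ _ f fy 1%R ltr01.
have [b [_ fb]] := @cvgr0_norm_le _ _ _ _ _ f fNy 1%R ltr01.
have cnf : continuous (fun x => `|f x|%R).
  by move=> x; apply: continuous_comp; [exact: cf|exact: norm_continuous].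
have ab : (Num.min a b <= Num.max a b)%R by rewrite ge_min le_max lexx.
have [c _ fc] := EVT_max ab (continuous_subspaceT cnf).
exists (Num.max 1%R `|f c|%R) => x; rewrite le_max.
have [ax|xa] := ltP a x; first by rewrite fa.
have [xb|bx] := ltP x b; first by rewrite fb.
by apply/orP; right; apply: fc; rewrite in_itv/= ge_min bx orbT le_max xa.
Qed.

(** A piecewise linear function equal to [1] on [[a + (m + 1)^-1, b]] and to [0]
    outside [[a, b + (m + 1)^-1]]. *)
Definition trapezoid (a b : R) (m : nat) (x : R) : R :=
  Num.max 0%R (Num.min 1%R
    (Num.min (m.+1%:R * (x - a))%R (1 - m.+1%:R * (x - b))%R)).

Lemma trapezoid_continuous a b m : continuous (trapezoid a b m).
Proof.
pose u x : R := (m.+1%:R * (x - a))%R.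
pose v x : R := (1 - m.+1%:R * (x - b))%R.
have affine_continuous c : continuous (fun x : R => m.+1%:R * (x - c))%R.
  move=> x; apply: cvgM; first exact: cvg_cst.
  by apply: cvgB; [exact: cvg_id|exact: cvg_cst].
have cu : continuous u by exact: affine_continuous.
have cv : continuous v.
  by move=> x; apply: cvgB; [exact: cvg_cst|exact: affine_continuous].
have c_ (r : R) : continuous (cst r : R -> R) by move=> x; exact: cvg_cst.
exact: (max_fun_continuous (c_ 0%R)
  (min_fun_continuous (c_ 1%R) (min_fun_continuous cu cv))).
Qed.

Lemma trapezoid_le1 a b m x : (`|trapezoid a b m x| <= 1)%R.
Proof.
rewrite ger0_norm /trapezoid ?le_max ?lexx//.
by rewrite ge_max ler01 ge_min lexx.
Qed.

Lemma trapezoid_left a b m x : (x <= a)%R -> trapezoid a b m x = 0%R.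
Proof.
move=> xa; apply/max_idPl; rewrite ge_min; apply/orP; right.
by rewrite ge_min mulr_ge0_le0// subr_le0.
Qed.

Lemma trapezoid_right a b m x :
  (m.+1%:R^-1 <= x - b)%R -> trapezoid a b m x = 0%R.
Proof.
move=> bx; apply/max_idPl; rewrite ge_min; apply/orP; right.
rewrite ge_min; apply/orP; right.
by rewrite subr_le0 -ler_pdivrMl// mulr1.
Qed.

Lemma trapezoid_top a b m x :
  (m.+1%:R^-1 <= x - a)%R -> (x <= b)%R -> trapezoid a b m x = 1%R.
Proof.
move=> ax xb; rewrite /trapezoid.
suff /min_idPl -> :
    (1 <= Num.min (m.+1%:R * (x - a))%R (1 - m.+1%:R * (x - b))%R)%R.
  by apply/max_idPr.
rewrite le_min -ler_pdivrMl// mulr1 ax/= lerBrDl gerDr.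
by rewrite mulr_ge0_le0// subr_le0.
Qed.

Lemma trapezoid_vanishes a b m : vanishes_at_infinity (trapezoid a b m).
Proof.
split; apply: cvg_near_cst.
- exists (b + m.+1%:R^-1)%R; split; first exact: num_real.
  by move=> x /ltW h; apply: trapezoid_right; rewrite lerBrDl.
- exists a; split; first exact: num_real.
  by move=> x /ltW; exact: trapezoid_left.
Qed.

(** The ramp next to [a] lies in the interval and the ramp next to [b] lies
    outside it; this is why the limit excludes [a] and includes [b]. *)
Lemma cvg_trapezoid a b x :
  trapezoid a b m x @[m --> \oo] --> (\1_(`]a, b]%classic) x : R).
Proof.
apply: cvg_near_cst; rewrite indicE.
have [xa|ax] := leP x a.
  rewrite memNset/= ?in_itv/= ?[(a < x)%R]ltNge ?xa//.
  by apply: nearW => m; exact: trapezoid_left.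
have [xb|bx] := leP x b.
  rewrite mem_set/= ?in_itv/= ?ax ?xb//.
  have xa0 : (0 < x - a)%R by rewrite subr_gt0.
  apply: filterS (near_infty_natSinv_lt (PosNum xa0)) => m /= /ltW h.
  exact: trapezoid_top.
rewrite memNset/= ?in_itv/= ?[(x <= b)%R]leNgt ?bx ?andbF//.
have xb0 : (0 < x - b)%R by rewrite subr_gt0.
apply: filterS (near_infty_natSinv_lt (PosNum xb0)) => m /= /ltW h.
exact: trapezoid_right.
Qed.

Lemma cvg_integral_trapezoid (Q : borel_prob R) a b :
  \int[Q]_x (trapezoid a b m x)%:E @[m --> \oo] --> Q `]a, b]%classic.
Proof.
have -> : Q `]a, b]%classic = \int[Q]_x (\1_(`]a, b]%classic) x)%:E.
  by rewrite integral_indic ?setIT//; exact: measurable_itv.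
apply: (@dominated_cvg _ _ _ _ _ measurableT _ _ (cst 1%:E)) => //.
- move=> m; apply/measurable_EFinP.
  exact: (continuous_measurable_fun (@trapezoid_continuous a b m)).
- move=> x _; apply: cvg_EFin; first exact: nearW.
  exact: cvg_trapezoid.
- exact: finite_measure_integrable_cst.
- by move=> m x _; rewrite lee_fin trapezoid_le1.
Qed.

Lemma vanishing_integrals_unique (Q Q' : borel_prob R) :
  (forall f : R -> R, continuous f -> vanishes_at_infinity f ->
    \int[Q]_x (f x)%:E = \int[Q']_x (f x)%:E) ->
  same_distribution Q Q'.
Proof.
move=> QQ' B mB.
apply: (@measure_unique _ R (measurableTypeR R) (@ocitv R)
  (fun k => `](- k%:R)%R, k%:R%R]%classic) erefl _ _ _ Q Q') => //.
- by move=> ? ?; exact: ocitvI.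
- by move=> k; exact: is_ocitv.
- apply/seteqP; split => // x _.
  exists (Num.truncn `|x|).+1 => //=; rewrite in_itv/=.
  have : (`|x| < (Num.truncn `|x|).+1%:R)%R by exact: truncnS_gt.
  by rewrite ltr_norml => /andP[-> /ltW ->].
- move=> _ [[a b] _ <-]/=.
  rewrite -(cvg_lim _ (@cvg_integral_trapezoid Q a b))//.
  rewrite -(cvg_lim _ (@cvg_integral_trapezoid Q' a b))//.
  suff -> : (fun m => \int[Q]_x (trapezoid a b m x)%:E) =
    (fun m => \int[Q']_x (trapezoid a b m x)%:E) by [].
  apply/funext => m.
  by apply: QQ'; [exact: trapezoid_continuous|exact: trapezoid_vanishes].
- by move=> k; rewrite (le_lt_trans (probability_le1 _ _)) ?ltry.
Qed.

End test_functions.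

(** * Integration against images of weighted measures *)

Section weighted_image.
Context {d d'} {T : measurableType d} {T' : measurableType d'} {R : realType}.
Variables (mu : {measure set T -> \bar R}) (c : T -> T') (g : T -> R).
Hypotheses (mc : measurable_fun setT c) (mg : measurable_fun setT g).
Hypothesis g0 : forall x, (0 <= g x)%R.

(** The image under [c] of the measure of density [g] with respect to [mu]. *)
Definition weighted_image (B : set T') : \bar R :=
  \int[mu]_x (g x * \1_B (c x))%:E.

Lemma measurable_weighted_indic B : measurable B ->
  measurable_fun setT (fun x => (g x * \1_B (c x))%R).
Proof. by move=> mB; apply: measurable_funM => //; exact: measurableT_comp. Qed.

(** Change of variables.  The measure [nu] only has to agree with the weighted
    image on measurable sets; the formula is then true for indicators, and
    extends to simple functions and to their monotone limits. *)
Lemma integral_weighted_image (nu : {measure set T' -> \bar R})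
    (f : T' -> \bar R) :
  (forall B, measurable B -> nu B = weighted_image B) ->
  measurable_fun setT f -> (forall y, 0 <= f y) ->
  \int[nu]_y f y = \int[mu]_x ((g x)%:E * f (c x)).
Proof.
move=> nuE mf f0; pose f_ := nnsfun_approx measurableT mf.
transitivity (limn (fun n => \int[nu]_x (f_ n x)%:E)).
  rewrite -monotone_convergence//.
  - apply: eq_integral => y _; apply/esym/cvg_lim => //.
    exact: cvg_nnsfun_approx.
  - by move=> n; exact/measurable_EFinP/measurable_funP.
  - by move=> n y _; rewrite lee_fin.
  - by move=> y _ m n mn; rewrite lee_fin; exact/lefP/nd_nnsfun_approx.
transitivity (limn (fun n => \int[mu]_x (g x * f_ n (c x))%:E)); last first.
  rewrite -monotone_convergence//.
  - apply: eq_integral => x _; apply/cvg_lim => //.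
    under eq_fun do rewrite EFinM.
    apply: cvgeZl => //; exact: cvg_nnsfun_approx.
  - move=> n; apply/measurable_EFinP; apply: measurable_funM => //.
    exact: measurableT_comp.
  - by move=> n x _; rewrite lee_fin mulr_ge0.
  - move=> x _ m n mn; rewrite lee_fin ler_wpM2l//.
    exact/lefP/nd_nnsfun_approx.
congr (limn _); apply/funext => n.
have mfn r : measurable (f_ n @^-1` [set r]) by [].
transitivity (\sum_(k \in range (f_ n))
    \int[mu]_x (k%:E * (g x * \1_(f_ n @^-1` [set k]) (c x))%:E)).
  under eq_integral do rewrite fimfunE -fsumEFin//.
  rewrite ge0_integral_fsum//; last 2 first.
  - by move=> y; exact/measurable_EFinP/measurable_funM.
  - by move=> y x _; rewrite nnfun_muleindic_ge0.
  apply: eq_fsbigr => r /[!inE] -[y _ <-].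
  rewrite integralZl_indic_nnsfun// integral_indic//= setIT nuE//.
  rewrite ge0_integralZl//.
  - exact/measurable_EFinP/measurable_weighted_indic.
  - by move=> x _; rewrite lee_fin mulr_ge0.
  - by rewrite lee_fin.
under [RHS]eq_integral => x _.
  rewrite [in X in X%:E]fimfunE EFinM -fsumEFin// ge0_mule_fsumr//; last first.
    by move=> r; rewrite nnfun_muleindic_ge0.
  under eq_fsbigr => r _ do rewrite -EFinM mulrCA EFinM.
  over.
rewrite [RHS]ge0_integral_fsum//.
- move=> r; apply: measurable_funeM.
  exact/measurable_EFinP/measurable_weighted_indic.
- move=> r x _; have := nnfun_muleindic_ge0 (f_ n) r (c x).
  by rewrite -EFinM mulrCA EFinM => h; rewrite mule_ge0// lee_fin.
Qed.

Lemma integral_weighted_image_fin (nu : {measure set T' -> \bar R})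
    (f : T' -> R) :
  (forall B, measurable B -> nu B = weighted_image B) ->
  measurable_fun setT f ->
  \int[nu]_y (f y)%:E = \int[mu]_x (g x * f (c x))%:E.
Proof.
move=> nuE /measurable_EFinP mf.
rewrite [LHS]integralE [RHS]integralE; congr (_ - _).
- rewrite (integral_weighted_image nuE)//; last exact: measurable_funepos.
  apply: eq_integral => x _.
  by rewrite !funeposE -!EFin_max -EFinM maxr_pMr// mulr0.
- rewrite (integral_weighted_image nuE)//; last exact: measurable_funeneg.
  apply: eq_integral => x _.
  by rewrite !funenegE -!EFinN -!EFin_max -EFinM maxr_pMr// mulr0 mulrN.
Qed.

Lemma weighted_image0 : weighted_image set0 = 0.
Proof. by apply: integral0_eq => x _; rewrite indic0 mulr0. Qed.

Lemma weighted_image_ge0 B : 0 <= weighted_image B.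
Proof. by apply: integral_ge0 => x _; rewrite lee_fin mulr_ge0. Qed.

Lemma weighted_image_sigma_additive : semi_sigma_additive weighted_image.
Proof.
move=> F mF tF mUF.
have -> : weighted_image (\bigcup_i F i) = \sum_(i <oo) weighted_image (F i).
  rewrite -integral_nneseries//.
  - apply: eq_integral => x _.
    under eq_eseriesr do rewrite EFinM.
    rewrite nneseriesZl// EFinM; congr (_ * _).
    exact: (measure_semi_bigcup (\d_(c x))).
  - by move=> n; exact/measurable_EFinP/measurable_weighted_indic.
  - by move=> n x _; rewrite lee_fin mulr_ge0.
by apply: is_cvg_ereal_nneg_natsum => i _; exact: weighted_image_ge0.
Qed.

Lemma weighted_image_measure :
  exists nu : {measure set T' -> \bar R}, forall B, nu B = weighted_image B.
Proof.
pose m := isMeasure.Build _ _ _ weighted_image weighted_image0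
  weighted_image_ge0 weighted_image_sigma_additive.
pose nu : {measure set T' -> \bar R} := HB.pack weighted_image m.
by exists nu.
Qed.

End weighted_image.

(** * Dyadic intervals *)

Section dyadic.
Context {R : realType}.
Implicit Types (x : R) (j : nat) (k : int).

(** The index [k] of the dyadic interval of level [j] containing [x]; the
    intervals are closed on the right, hence the ceiling. *)
Definition dyadic_cell j x : int := Num.ceil (x * 2 ^+ j)%R.

(** The right endpoint of the dyadic interval of level [j] containing [x]. *)
Definition dyadic_round j x : R := dyadic_point j (dyadic_cell j x).

Lemma dyadic_itvP j k x : dyadic_itv j k x <-> dyadic_cell j x = k.
Proof.
rewrite /dyadic_itv/= in_itv/= /dyadic_point ltr_pdivrMr ?exprn_gt0//.
rewrite ler_pdivlMr ?exprn_gt0// -ceil_eq.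
by split => [/eqP//|<-]; exact: eqxx.
Qed.

Lemma dyadic_round_bounds j x :
  (x <= dyadic_round j x)%R /\ (dyadic_round j x < x + 2 ^- j)%R.
Proof.
have /dyadic_itvP : dyadic_cell j x = dyadic_cell j x by [].
rewrite /dyadic_itv/= in_itv/= -/(dyadic_round j x) => /andP[h ->]; split => //.
move: h; rewrite /dyadic_round /dyadic_point intrB mulrBl mul1r.
by rewrite ltrBlDr.
Qed.

Lemma cvg_half_expn : (2 ^- j : R) @[j --> \oo] --> (0 : R)%R.
Proof.
under eq_fun do rewrite -exprVn.
by apply: cvg_expr; rewrite ger0_norm ?invr_ge0// invf_lt1 ?ltr1n.
Qed.

Lemma cvg_dyadic_round x : dyadic_round j x @[j --> \oo] --> x.
Proof.
apply: (@squeeze_cvgr _ _ _ _ (cst x) (fun j => x + 2 ^- j)%R).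
- apply: nearW => j; have [-> /ltW ->] := dyadic_round_bounds j x; by [].
- exact: cvg_cst.
- rewrite -[X in _ --> X]addr0; apply: cvgD; first exact: cvg_cst.
  exact: cvg_half_expn.
Qed.

Lemma measurable_dyadic_itv j k :
  measurable (dyadic_itv j k : set (measurableTypeR R)).
Proof. exact: measurable_itv. Qed.

(** A bijection from the natural numbers to the integers: even codes give the
    nonnegative integers, odd codes the negative ones. *)
Definition int_of_code m : int := if odd m then Negz m./2 else Posz m./2.

Lemma int_of_code_bij : set_bij [set: nat] [set: int] int_of_code.
Proof.
pose code k := match k with Posz m => m.*2 | Negz m => m.*2.+1 end.
have codeK : cancel int_of_code code.
  move=> m; rewrite /int_of_code -[RHS]odd_double_half; by case: (odd m).
split => // [m p _ _|[m|m] _] /=; first exact: (can_inj codeK).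
- exists m.*2 => //; by rewrite /int_of_code odd_double doubleK.
- exists m.*2.+1 => //.
  by rewrite /int_of_code oddS odd_double/= uphalf_double.
Qed.

Lemma dyadic_itv_cover j :
  \bigcup_m dyadic_itv j (int_of_code m) = [set: measurableTypeR R].
Proof.
apply/seteqP; split => // x _; have [_ _ sur] := int_of_code_bij.
have [m _ mE] := sur (dyadic_cell j x) I.
by exists m => //; apply/dyadic_itvP.
Qed.

Lemma dyadic_itv_trivIset j :
  trivIset setT (fun m => @dyadic_itv R j (int_of_code m)).
Proof.
move=> m p _ _ [x [/dyadic_itvP xm /dyadic_itvP xp]].
have [_ inj _] := int_of_code_bij.
by apply: inj; rewrite ?inE// -xm -xp.
Qed.

Lemma measurable_dyadic_cell j (F : int -> R) :
  measurable_fun [set: measurableTypeR R] (fun x => F (dyadic_cell j x)).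
Proof.
rewrite -(dyadic_itv_cover j); apply/measurable_fun_bigcup => m.
  exact: measurable_dyadic_itv.
apply: (eq_measurable_fun (cst (F (int_of_code m)))).
  by move=> x; rewrite inE => /dyadic_itvP ->.
exact: measurable_cst.
Qed.

(** The dyadic interval containing [x] lies between [{x}] and the closed
    interval of center [x] and radius [2^-j]; the latter intervals decrease to
    [{x}]. *)
Lemma cvg_measure_dyadic_itv (Q : borel_prob R) x :
  Q (dyadic_itv j (dyadic_cell j x)) @[j --> \oo] --> Q [set x].
Proof.
pose J j : set (measurableTypeR R) := `[x - 2 ^- j, x + 2 ^- j]%classic%R.
have mJ j : measurable (J j) by exact: measurable_itv.
have QJ : Q (J j) @[j --> \oo] --> Q [set x].
  have -> : [set x] = \bigcap_j J j.
    apply/seteqP; split => [_ -> j _|y Jy] /=.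
      by rewrite /J/= in_itv/= gerBl lerDl invr_ge0 exprn_ge0.
    have yx j : (`|y - x| <= 2 ^- j)%R.
      have := Jy j I; rewrite /J/= in_itv/= => /andP[h1 h2].
      by rewrite ler_distl h1 h2.
    apply/eqP; rewrite -subr_eq0 -normr_le0.
    rewrite -(cvg_lim (@Rhausdorff R) cvg_half_expn).
    apply: limr_ge; last exact: nearW.
    by apply/cvg_ex; exists 0%R; exact: cvg_half_expn.
  apply: nonincreasing_cvg_mu => //.
  - by rewrite (le_lt_trans (probability_le1 _ _))// ltry.
  - exact: bigcap_measurable.
  - move=> m p mp; apply/subsetPset => y; rewrite /J/= !in_itv/=.
    have : (2 ^- p <= 2 ^- m :> R)%R.
      by rewrite lef_pV2 ?posrE ?exprn_gt0// ler_weXn2l// ler1n.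
    move=> h /andP[h1 h2]; apply/andP; split.
      by apply: le_trans h1; rewrite lerB.
    by apply: (le_trans h2); rewrite lerD2l.
apply: (squeeze_cvge _ (cvg_cst (Q [set x])) QJ); apply: nearW => j.
apply/andP; split; apply: le_measure; rewrite ?inE//.
- exact: measurable_dyadic_itv.
- by move=> _ ->; apply/dyadic_itvP.
- exact: measurable_dyadic_itv.
- move=> y; rewrite /J/= in_itv/= => /dyadic_itvP yx.
  have [x1 x2] := dyadic_round_bounds j x.
  have [y1 y2] := dyadic_round_bounds j y.
  move: y1 y2; rewrite {1 2}/dyadic_round yx -/(dyadic_round j x) => y1 y2.
  by apply/andP; split; [rewrite lerBlDr; apply/ltW/(le_lt_trans x1)|
    apply/(le_trans y1)/ltW].
Qed.

End dyadic.

(** * Limit of the discretized measures *)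

Section conflation_limit.
Context {R : realType} {n : nat} (P : 'I_n -> borel_prob R) (i0 : 'I_n).
Implicit Types (x : R) (j : nat) (B : set (measurableTypeR R)).

(** The product of the masses of [B] under all the [P i] but [P i0]. *)
Definition co_mass B : R := (\prod_(i < n | i != i0) fine (P i B))%R.

Lemma co_mass_ge0 B : (0 <= co_mass B)%R.
Proof. by apply: prodr_ge0 => i _; exact: fine_ge0. Qed.

Lemma co_mass_le B C :
  measurable B -> measurable C -> B `<=` C -> (co_mass B <= co_mass C)%R.
Proof.
move=> mB mC BC; apply: ler_prod => i _; rewrite fine_ge0//=.
by apply: fine_le; rewrite ?probability_fin_num// le_measure// inE.
Qed.

Lemma co_mass_le1 B : measurable B -> (co_mass B <= 1)%R.
Proof.
move=> mB; apply: prodr_ile1 => i _; rewrite fine_ge0//=.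
by rewrite -lee_fin fineK ?probability_fin_num// probability_le1.
Qed.

Lemma prod_co_mass B : measurable B ->
  \prod_(i < n) P i B = (co_mass B)%:E * P i0 B.
Proof.
move=> mB; rewrite (bigD1 i0)//= muleC; congr (_ * _).
rewrite /co_mass -prodEFin; apply: eq_bigr => i _.
by rewrite fineK// probability_fin_num.
Qed.

(** The density, with respect to [P i0], of the measure charging each point [x]
    with [\prod_i P i {x}]. *)
Definition co_density x : R := co_mass [set x].

(** The approximation of [co_density] in which the point [x] is replaced by the
    dyadic interval of level [j] containing it. *)
Definition cell_co_mass j x : R := co_mass (dyadic_itv j (dyadic_cell j x)).

Lemma measurable_cell_co_mass j :
  measurable_fun [set: measurableTypeR R] (cell_co_mass j).
Proof.
exact: (measurable_dyadic_cell j (fun k => co_mass (dyadic_itv j k))).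
Qed.

Lemma measurable_dyadic_round j :
  measurable_fun [set: measurableTypeR R]
    (@dyadic_round R j : _ -> measurableTypeR R).
Proof. exact: measurable_dyadic_cell. Qed.

Lemma cvg_cell_co_mass x : cell_co_mass j x @[j --> \oo] --> co_density x.
Proof.
apply: cvg_big => [|i _]; first exact: mul_continuous.
apply: fine_cvg; rewrite fineK ?probability_fin_num//.
exact: cvg_measure_dyadic_itv.
Qed.

Lemma measurable_co_density :
  measurable_fun [set: measurableTypeR R] co_density.
Proof.
apply: measurable_fun_cvg; first exact: measurable_cell_co_mass.
by move=> x _; exact: cvg_cell_co_mass.
Qed.

(** On each dyadic interval of level [j] the density and the image point are
    constant, so the integral over that interval is one term of the sum. *)
Lemma mu_dyadicE j B : measurable B ->
  mu_dyadic P j B =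
  weighted_image (P i0) (@dyadic_round R j : _ -> measurableTypeR R)
    (cell_co_mass j) B.
Proof.
move=> mB; rewrite /mu_dyadic (reindex_esum _ _ _ _ int_of_code_bij).
rewrite -nneseries_esumT; last first.
  by move=> m; rewrite mule_ge0// dyadic_weight_ge0.
rewrite /weighted_image -[in RHS](dyadic_itv_cover j).
rewrite ge0_integral_bigcup//; last 4 first.
- by move=> m; exact: measurable_dyadic_itv.
- rewrite dyadic_itv_cover; apply/measurable_EFinP.
  apply: measurable_weighted_indic => //.
    exact: measurable_dyadic_round.
  exact: measurable_cell_co_mass.
- by move=> x _; rewrite lee_fin mulr_ge0// co_mass_ge0.
- exact: dyadic_itv_trivIset.
apply: eq_eseriesr => m _; set k := int_of_code m.
rewrite (eq_integral (cst (co_mass (dyadic_itv j k) *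
    \1_B (dyadic_point j k : measurableTypeR R))%:E)); last first.
  move=> x; rewrite inE => /dyadic_itvP xk.
  by rewrite /cell_co_mass /dyadic_round xk.
rewrite integral_cst; last exact: measurable_dyadic_itv.
rewrite /dyadic_weight prod_co_mass; last exact: measurable_dyadic_itv.
by rewrite EFinM muleAC diracE.
Qed.

Lemma cvg_integral_mu_dyadic (f : R -> R) (M : R) :
  continuous f -> (forall x, (`|f x| <= M)%R) ->
  \int[mu_dyadic P j]_x (f x)%:E @[j --> \oo] -->
  \int[P i0]_x (co_density x * f x)%:E.
Proof.
move=> cf fM; have mf := continuous_measurable_fun cf.
under eq_fun do rewrite (integral_weighted_image_fin (measurable_dyadic_round _)
  (measurable_cell_co_mass _) (fun x => co_mass_ge0 _) (@mu_dyadicE _) mf).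
apply: (@dominated_cvg _ _ _ _ _ measurableT _ _ (cst M%:E)) => //.
- move=> j; apply/measurable_EFinP; apply: measurable_funM.
    exact: measurable_cell_co_mass.
  apply: measurableT_comp => //; exact: measurable_dyadic_round.
- move=> x _; apply: cvg_EFin; first exact: nearW.
  apply: cvgM; first exact: cvg_cell_co_mass.
  apply: continuous_cvg; [exact: cf|exact: cvg_dyadic_round].
- exact: finite_measure_integrable_cst.
- move=> j x _; rewrite lee_fin normrM ger0_norm ?co_mass_ge0//.
  rewrite -[leRHS]mul1r ler_pM ?co_mass_ge0// co_mass_le1//.
  exact: measurable_dyadic_itv.
Qed.

End conflation_limit.

(** * The normalized product of the atoms *)

Section normalized_atom_product.
Context {R : realType} {n : nat} (P : 'I_n -> borel_prob R) (i0 : 'I_n).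
Implicit Types (x : R) (B : set (measurableTypeR R)) (Q : borel_prob R).

(** The measure of density [co_density] with respect to [P i0].  When [P i0] is
    discrete it is [B |-> \sum_(x in B) \prod_i P i {x}]. *)
Definition atom_product B : \bar R :=
  weighted_image (P i0) (fun x : measurableTypeR R => x) (co_density P i0) B.

Lemma atom_product_measure :
  exists nu : {measure set (measurableTypeR R) -> \bar R},
  forall B, nu B = atom_product B.
Proof.
apply: weighted_image_measure => //; first exact: measurable_co_density.
by move=> x; exact: co_mass_ge0.
Qed.

Lemma atom_product_le B : measurable B ->
  atom_product B <= \prod_(i < n) P i B.
Proof.
move=> mB; rewrite (prod_co_mass P i0)//.
rewrite -[X in _ * P i0 X]setIT -integral_indic//.
rewrite -ge0_integralZl//; last 2 first.
- exact/measurable_EFinP.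
- by rewrite lee_fin co_mass_ge0.
apply: ge0_le_integral => //.
- by move=> x _; rewrite lee_fin mulr_ge0// co_mass_ge0.
- apply/measurable_EFinP; apply: measurable_weighted_indic => //.
  exact: measurable_co_density.
- by apply: measurable_funeM; exact/measurable_EFinP.
move=> x _; rewrite -EFinM lee_fin indicE.
case: (boolP (x \in B)) => [|_]; last by rewrite !mulr0.
rewrite inE !mulr1 => Bx; apply: co_mass_le => //.
by move=> _ ->.
Qed.

Lemma atom_product_set1 x : atom_product [set x] = \prod_(i < n) P i [set x].
Proof.
rewrite (prod_co_mass P i0)// -[X in _ * P i0 X]setIT -integral_indic//.
rewrite -ge0_integralZl//; last 2 first.
- exact/measurable_EFinP.
- by rewrite lee_fin co_mass_ge0.
apply: eq_integral => y _; rewrite -EFinM indicE.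
case: (boolP (y \in [set x])) => [|_]; last by rewrite !mulr0.
by rewrite inE => ->.
Qed.

(** The total mass of [atom_product], finite by [atom_productT]. *)
Definition atom_mass : R := fine (atom_product setT).

Lemma atom_productT : atom_product setT = atom_mass%:E.
Proof.
have [nu nuE] := atom_product_measure.
rewrite fineK// ge0_fin_numE -?nuE// nuE.
apply: le_lt_trans (atom_product_le _) _ => //.
rewrite ltey_eq prode_fin_num// => i _; exact: fin_num_measure.
Qed.

Lemma atom_mass_bounds : common_atoms P !=set0 -> (0 < atom_mass <= 1)%R.
Proof.
move=> [x Px]; rewrite -lte_fin -lee_fin -atom_productT; apply/andP; split.
  have [nu nuE] := atom_product_measure.
  apply: (@lt_le_trans _ _ (atom_product [set x])); last first.
    by rewrite -!nuE le_measure ?inE.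
  rewrite atom_product_set1; elim/big_ind : _ => // y z; exact: mule_gt0.
apply: le_trans (atom_product_le _) _ => //.
by rewrite big1// => i _; exact: probability_setT.
Qed.

(** [Q] is, on Borel sets, the normalization of [atom_product]. *)
Definition normalized_atom_product Q : Prop :=
  forall B, measurable B -> Q B = atom_mass^-1%:E * atom_product B.

Lemma normalized_atom_product_exists :
  common_atoms P !=set0 -> exists Q, normalized_atom_product Q.
Proof.
move=> /atom_mass_bounds/andP[m0 _]; have [nu nuE] := atom_product_measure.
pose Q : borel_prob R := mnormalize nu (P i0).
exists Q => B mB; rewrite /Q/= /mnormalize nuE atom_productT.
by rewrite eqe gt_eqF//= nuE muleC.
Qed.

Lemma integral_normalized_atom_product Q (f : R -> R) :
  common_atoms P !=set0 -> normalized_atom_product Q ->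
  measurable_fun [set: measurableTypeR R] f ->
  \int[Q]_x (f x)%:E =
  \int[P i0]_x (atom_mass^-1 * co_density P i0 x * f x)%:E.
Proof.
move=> /atom_mass_bounds/andP[m0 _] QE mf.
have m0' : (0 <= atom_mass^-1)%R by rewrite invr_ge0 ltW.
have md := measurable_co_density P i0.
rewrite (integral_weighted_image_fin (mu := P i0)
  (c := fun x : measurableTypeR R => x)
  (g := fun x => (atom_mass^-1 * co_density P i0 x)%R))//.
- exact: measurable_funM.
- by move=> x; rewrite mulr_ge0// co_mass_ge0.
- move=> B mB; apply: etrans (QE _ mB) _.
  rewrite /atom_product /weighted_image -ge0_integralZl//.
  + by apply: eq_integral => x _; rewrite -EFinM mulrA.
  + by apply/measurable_EFinP; exact: measurable_weighted_indic.
  + by move=> x _; rewrite lee_fin mulr_ge0// co_mass_ge0.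
Qed.

Lemma mu_dyadic_le1 j : mu_dyadic P j setT <= 1.
Proof.
rewrite (mu_dyadicE P i0)// /weighted_image.
have -> : 1 = \int[P i0]_x (cst 1%E x).
  by rewrite integral_cst// mul1e; exact/esym/probability_setT.
apply: ge0_le_integral => //.
- by move=> x _; rewrite lee_fin mulr_ge0// co_mass_ge0.
- apply/measurable_EFinP; apply: measurable_weighted_indic => //.
    exact: measurable_dyadic_round.
  exact: measurable_cell_co_mass.
- move=> x _; rewrite lee_fin indicE in_setT mulr1 co_mass_le1//.
  exact: measurable_dyadic_itv.
Qed.

Lemma normalized_atom_product_conflation Q :
  common_atoms P !=set0 -> normalized_atom_product Q -> is_conflation P Q.
Proof.
move=> A0 QE f cf f0; have [M fM] := vanishing_bounded cf f0.
have /andP[z0 _] := atom_mass_bounds A0.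
have mf := continuous_measurable_fun cf.
rewrite (integral_normalized_atom_product A0 QE mf).
have intf : (P i0).-integrable setT (fun x => (co_density P i0 x * f x)%:E).
  apply: measurable_bounded_integrable => //.
  - by rewrite -ge0_fin_numE ?fin_num_measure.
  - by apply: measurable_funM => //; exact: measurable_co_density.
  - exists M; split; first exact: num_real.
    move=> K MK x _ /=; rewrite normrM ger0_norm ?co_mass_ge0//.
    rewrite (le_trans _ (ltW MK))// -[leRHS]mul1r.
    by rewrite ler_pM ?co_mass_ge0// co_mass_le1.
under eq_integral do rewrite -mulrA EFinM.
rewrite integralZl//.
have normE : (fun j => (fine (mu_dyadic P j setT))^-1%:E *
      \int[mu_dyadic P j]_x (f x)%:E) =
    (fun j => \int[normalized (mu_dyadic P j)]_x (f x)%:E).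
  apply/funext => j; apply/esym; apply: integral_normalized mf fM.
  exact: le_lt_trans (mu_dyadic_le1 j) (ltry _).
rewrite -normE.
apply: cvgeM.
- by rewrite mule_def_fin// integrable_fin_num.
- apply: cvg_EFin; first exact: nearW.
  apply: cvgV; first by rewrite gt_eqF.
  apply: fine_cvg.
  have -> : (fun j => mu_dyadic P j setT) =
      (fun j => \int[mu_dyadic P j]_x (cst 1%R x)%:E).
    apply/funext => j; rewrite (eq_integral (cst 1%E))//.
    by rewrite integral_cst// mul1e.
  rewrite -atom_productT /atom_product /weighted_image.
  under eq_integral do rewrite indicE in_setT.
  apply: (@cvg_integral_mu_dyadic _ _ P i0 (cst 1%R) 1%R).
    by move=> x; exact: cvg_cst.
  by move=> x; rewrite /= normr1.
- exact: cvg_integral_mu_dyadic cf fM.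
Qed.

(** Inside a countable set carrying [P i0] the bound on singletons suffices,
    since [atom_product] and the product of the [P i] agree on singletons;
    outside it the bound forces [Q'] to vanish. *)
Lemma atom_product_dominating Q Q' :
  common_atoms P !=set0 -> normalized_atom_product Q ->
  discrete_probability (P i0) ->
  (forall B, measurable B -> Q' B <= atom_mass^-1%:E * \prod_(i < n) P i B) ->
  forall B, measurable B -> Q' B <= Q B.
Proof.
move=> /atom_mass_bounds/andP[z0 _] QE [D cD PD1] Q'le B mB.
have mD : measurable (D : set (measurableTypeR R)).
  exact: countable_measurable.
have Q'D : Q' (B `\` D) = 0.
  apply/eqP; rewrite -measure_le0.
  have mBD : measurable (B `\` D) by exact: measurableD.
  apply: le_trans (Q'le _ mBD) _.
  rewrite (prod_co_mass P i0)//.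
  suff -> : P i0 (B `\` D) = 0 by rewrite !mule0.
  apply: (@subset_measure0 _ _ _ (P i0) _ (~` D)) => //.
  - exact: measurableC.
  - apply: etrans (probability_setC (P i0) mD) _.
    by rewrite PD1 subee.
have -> : Q' B = Q' (B `&` D).
  apply: etrans (measureDI Q' mB mD) _; rewrite -[RHS]add0e.
  by congr (_ + _); exact: Q'D.
apply: (@le_trans _ _ (Q (B `&` D))); last first.
  by apply: le_measure; rewrite ?inE//; exact: measurableI.
have [f finj] := countable_injP _ cD.
(* [F k] consists of the point of [B `&` D] with code [k], if there is one. *)
pose F k : set (measurableTypeR R) := (B `&` D) `&` f @^-1` [set k].
have FE : B `&` D = \bigcup_k F k.
  by apply/seteqP; split => [x BDx|x [k _ []//]]; exists (f x).
have F1 k x : F k x -> F k = [set x].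
  move=> Fx; apply/seteqP; split => [y Fy|_ -> //].
  case: Fx Fy => [[_ Dx] /= fx] [[_ Dy] /= fy].
  by apply: finj; rewrite ?inE// fx fy.
have Fset k : F k = set0 \/ exists x, F k = [set x].
  have [->|/set0P[x /F1 Fx]] := eqVneq (F k) set0; first by left.
  by right; exists x.
have mF k : measurable (F k) by case: (Fset k) => [->|[x ->]].
have tF : trivIset setT F by move=> k l _ _ [x [[_ <-] [_ <-]]].
rewrite FE !measure_bigcup//; apply: lee_nneseries => // k _.
case: (Fset k) => [->|[x ->]]; first by rewrite !measure0.
apply: le_trans (Q'le _ (measurable_set1 x)) _.
by rewrite -atom_product_set1 le_eqVlt; apply/orP; left; apply/eqP/esym/QE.
Qed.

End normalized_atom_product.

(** * The minimizing property of the conflation *)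

Theorem corollary4p4 (R : realType) (n : nat) (n_gt0 : (0 < n)%N)
    (P : 'I_n -> borel_prob R)
    (P_discrete : forall i, discrete_probability (P i))
    (A_nonempty : common_atoms P !=set0) :
  (exists Q : borel_prob R, is_conflation P Q) /\
  (forall Q : borel_prob R, is_conflation P Q ->
    minimizes_max_loss P Q /\
    (forall Q' : borel_prob R,
       minimizes_max_loss P Q' -> same_distribution Q' Q)).
Proof.
pose i0 := Ordinal n_gt0; pose z := atom_mass P i0.
have z01 : (0 < z <= 1)%R := atom_mass_bounds i0 A_nonempty.
have [Q0 Q0E] := normalized_atom_product_exists i0 A_nonempty.
have Q0conf := normalized_atom_product_conflation A_nonempty Q0E.
have Q0loss : max_loss Q0 P <= (- (ln z / ln 2))%:E.
  apply/(max_loss_leP _ _ z01) => B mB; rewrite Q0E//.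
  rewrite lee_wpmul2l ?atom_product_le// lee_fin invr_ge0 ltW//.
  by case/andP: z01.
have only_Q0 Q' : max_loss Q' P <= (- (ln z / ln 2))%:E ->
    same_distribution Q' Q0.
  move=> /(max_loss_leP _ _ z01) Q'le; apply: dominated_probability_eq.
  exact: atom_product_dominating Q0E (P_discrete i0) Q'le.
split; first by exists Q0.
move=> Q Qconf.
have QQ0 : same_distribution Q Q0.
  apply: vanishing_integrals_unique => f cf f0.
  exact: cvg_unique (Qconf f cf f0) (Q0conf f cf f0).
split=> [Q'|Q' Q'min B mB].
  rewrite (same_distribution_max_loss P QQ0).
  have [/only_Q0 Q'Q0|/ltW Q'loss] := leP (max_loss Q' P) (- (ln z / ln 2))%:E.
    by rewrite (same_distribution_max_loss P Q'Q0).
  exact: le_trans Q0loss Q'loss.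
rewrite QQ0//; apply: only_Q0 => //.
exact: le_trans (Q'min Q0) Q0loss.
Qed.
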